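(* The function $$V(z,D,\lambda)=mgR(1-\alpha z)+\frac{\big(\lambda(\alpha-(1-\gamma)z)+RD\sqrt{\gamma+\alpha^2-1}\,(\alpha-z)\big)^2}{2I_3R^2\gamma^2(\gamma+\alpha^2-1)(1-z^2)}+\frac{R^2D^2(\gamma+\alpha^2-1)-(1-\gamma)\lambda^2}{2R^2I_1(\gamma+\alpha^2-1)}$$ is convex as a function of $z\in(-1,1)$, for all real values of $D$ and $\lambda$.
   Context: The constants $m,g,R,I_1,I_3$ are positive real numbers, $0<\alpha<1$, $\gamma=I_1/I_3$, and it is assumed that $1-\alpha^2<\gamma<1$ and that $\sigma:=mR^2/I_3$ satisfies $\sigma=\frac{1-\gamma}{\gamma+\alpha^2-1}$. (Here $V$ is the rational effective potential of the tippe top, with $z=\cos\theta$.) *)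

(* Defs.v *)
From mathcomp Require Import all_boot all_order all_algebra.
From mathcomp Require Import all_classical all_reals all_analysis.

Set Implicit Arguments.
Unset Strict Implicit.
Unset Printing Implicit Defensive.

Import Order.TTheory GRing.Theory Num.Theory.
Local Open Scope ring_scope.

(* The rational effective potential of the tippe top, as a function of
   z = cos theta.  [K] is the field of real numbers and [R] the radius of the
   sphere; [gamma] stands for [I1 / I3]. *)
Definition effective_potential (K : realType)
    (m g R I1 I3 alpha gamma : K) (D lambda z : K) : K :=
  m * g * R * (1 - alpha * z)
  + (lambda * (alpha - (1 - gamma) * z)
     + R * D * Num.sqrt (gamma + alpha ^+ 2 - 1) * (alpha - z)) ^+ 2
    / (2 * I3 * R ^+ 2 * gamma ^+ 2 * (gamma + alpha ^+ 2 - 1) * (1 - z ^+ 2))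
  + (R ^+ 2 * D ^+ 2 * (gamma + alpha ^+ 2 - 1) - (1 - gamma) * lambda ^+ 2)
    / (2 * R ^+ 2 * I1 * (gamma + alpha ^+ 2 - 1)).

(* Main.v *)
Require Import Defs.
From mathcomp Require Import all_boot all_order all_algebra.
From mathcomp Require Import all_classical all_reals all_analysis.
From mathcomp Require Import ring lra.

Import Order.TTheory GRing.Theory Num.Theory.
Local Open Scope classical_set_scope.
Local Open Scope ring_scope.

(** The numerator of the singular term is the square of an affine function
    [a + b z], and [(a + b z)^2 / (1 - z^2)] equals
    [- b^2 + (a + b)^2 / (2 (1 - z)) + (a - b)^2 / (2 (1 + z))].  Hence [V] is an
    affine function of [z] plus a nonnegative combination of the convex
    functions [1 / (1 - z)] and [1 / (1 + z)]. *)

Lemma conv_gt0 (K : realFieldType) (t u v : K) :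
  0 <= t <= 1 -> 0 < u -> 0 < v -> 0 < t * u + (1 - t) * v.
Proof.
move=> /andP[t0 t1] u0 v0.
(* At [t = 0] the sum is [v]; otherwise [t * u] is already strictly positive and the other term is
   nonnegative. *)
have [->|tn0] := eqVneq t 0; first by rewrite mul0r add0r subr0 mul1r.
by apply: ltr_wpDr; [nra | rewrite mulr_gt0// lt_neqAle eq_sym tn0].
Qed.

(** The gap between the two sides is an explicit fraction with numerator
    [t * (1 - t) * (u - v) ^+ 2] and positive denominator. *)
Lemma inv_conv_le (K : realFieldType) (t u v : K) :
  0 <= t <= 1 -> 0 < u -> 0 < v ->
  (t * u + (1 - t) * v)^-1 <= t * u^-1 + (1 - t) * v^-1.
Proof.
move=> t01 u0 v0; have w0 := conv_gt0 _ _ _ _ t01 u0 v0.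
case/andP: t01 => t0 t1.
rewrite -subr_ge0.
have -> : t * u^-1 + (1 - t) * v^-1 - (t * u + (1 - t) * v)^-1
    = t * (1 - t) * (u - v) ^+ 2 / (u * v * (t * u + (1 - t) * v)).
  by field; rewrite !gt_eqF.
by rewrite divr_ge0// ?(ltW (mulr_gt0 (mulr_gt0 u0 v0) w0))// mulr_ge0 ?sqr_ge0//
   mulr_ge0 ?subr_ge0.
Qed.

Lemma sqr_affine_div_1Bsqr (K : realFieldType) (a b z : K) : -1 < z < 1 ->
  (a + b * z) ^+ 2 / (1 - z ^+ 2)
  = - b ^+ 2 + (a + b) ^+ 2 / 2 * (1 - z)^-1 + (a - b) ^+ 2 / 2 * (1 + z)^-1.
Proof.
move=> /andP[z1 z2].
have z1n : 1 - z != 0 by rewrite gt_eqF// subr_gt0.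
have z2n : 1 + z != 0 by rewrite gt_eqF// -ltrBlDl sub0r.
have zn : 1 - z ^+ 2 != 0 by rewrite -[1](expr1n _ 2) subr_sqr mulf_neq0.
by field; apply/and3P.
Qed.

Lemma sqr_affine_div_1Bsqr_conv_le (K : realFieldType) (a b t x y : K)
    (z := t * x + (1 - t) * y) :
  0 <= t <= 1 -> -1 < x < 1 -> -1 < y < 1 ->
  (a + b * z) ^+ 2 / (1 - z ^+ 2)
  <= t * ((a + b * x) ^+ 2 / (1 - x ^+ 2))
     + (1 - t) * ((a + b * y) ^+ 2 / (1 - y ^+ 2)).
Proof.
move=> t01 x1 y1.
have [x_lt x_gt] : 0 < 1 - x /\ 0 < 1 + x by lra.
have [y_lt y_gt] : 0 < 1 - y /\ 0 < 1 + y by lra.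
(* Affine maps commute with convex combinations, so the bounds on [x] and [y] and the convexity of
   the inverse both carry over to [1 - z] and [1 + z]. *)
have z_ltE : t * (1 - x) + (1 - t) * (1 - y) = 1 - z by rewrite /z; ring.
have z_gtE : t * (1 + x) + (1 - t) * (1 + y) = 1 + z by rewrite /z; ring.
have z1 : -1 < z < 1.
  have := conv_gt0 _ _ _ _ t01 x_lt y_lt; have := conv_gt0 _ _ _ _ t01 x_gt y_gt.
  by rewrite z_ltE z_gtE; lra.
rewrite !sqr_affine_div_1Bsqr//.
have := inv_conv_le _ _ _ _ t01 x_lt y_lt; have := inv_conv_le _ _ _ _ t01 x_gt y_gt.
rewrite z_ltE z_gtE.
have p0 : 0 <= (a + b) ^+ 2 / 2 by rewrite divr_ge0 ?sqr_ge0.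
have q0 : 0 <= (a - b) ^+ 2 / 2 by rewrite divr_ge0 ?sqr_ge0.
(* The constant [- b ^+ 2] cancels because the weights sum to 1; the two scaled inequalities add up
   to the claim. *)
by move=> /(ler_wpM2l q0) + /(ler_wpM2l p0); lra.
Qed.

Theorem proposition1 (K : realType) (m g R I1 I3 alpha gamma sigma : K)
  (hm : 0 < m) (hg : 0 < g) (hR : 0 < R) (hI1 : 0 < I1) (hI3 : 0 < I3)
  (halpha : 0 < alpha < 1)
  (gammaE : gamma = I1 / I3)
  (hgamma : 1 - alpha ^+ 2 < gamma < 1)
  (sigmaE : sigma = m * R ^+ 2 / I3)
  (hsigma : sigma = (1 - gamma) / (gamma + alpha ^+ 2 - 1))
  (D lambda : K) :
  convex_function (`]-1, 1[ : set K)
    (effective_potential m g R I1 I3 alpha gamma D lambda).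
Proof.
move=> t x y /set_mem /=; rewrite in_itv/= => x1 /set_mem /=.
rewrite in_itv/= => y1.
set s := Num.sqrt (gamma + alpha ^+ 2 - 1).
(* [a] and [b] collect the powers of [z] in the squared numerator; [c] is the part of its
   denominator that is free of [z]. *)
pose a := alpha * (lambda + R * D * s).
pose b := - ((1 - gamma) * lambda + R * D * s).
pose c := 2 * I3 * R ^+ 2 * gamma ^+ 2 * (gamma + alpha ^+ 2 - 1).
have c0 : 0 <= c^-1.
  have d0 : 0 <= gamma + alpha ^+ 2 - 1 by case/andP: hgamma; lra.
  rewrite invr_ge0 mulr_ge0// mulr_ge0 ?sqr_ge0// mulr_ge0 ?sqr_ge0//.
  by rewrite mulr_ge0// ltW.
have VE z : effective_potential m g R I1 I3 alpha gamma D lambda z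
    = m * g * R * (1 - alpha * z)
      + c^-1 * ((a + b * z) ^+ 2 / (1 - z ^+ 2))
      + (R ^+ 2 * D ^+ 2 * (gamma + alpha ^+ 2 - 1) - (1 - gamma) * lambda ^+ 2)
        / (2 * R ^+ 2 * I1 * (gamma + alpha ^+ 2 - 1)).
  rewrite /effective_potential -/s -/c invfM.
  have -> : lambda * (alpha - (1 - gamma) * z) + R * D * s * (alpha - z) = a + b * z.
    by rewrite /a /b; ring.
  by rewrite mulrCA mulrA.
have t01 : 0 <= (t%:num : K) <= 1 by apply/andP; split.
have := ler_wpM2l c0 (sqr_affine_div_1Bsqr_conv_le _ a b _ _ _ t01 x1 y1).
(* The first and last terms of [VE] are affine in [z], hence contribute equality; the scaled
   singular term gives the inequality. *)
rewrite (_ : conv t x y = t%:num * x + (1 - t%:num) * y)// convRE !VE /unstable.onem /=.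
lra.
Qed.
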